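(* Let $\alpha,\beta,\gamma,\delta,\kappa$ be positive integers with $0<\gamma+\delta\le\beta+\kappa$ and $\kappa\le\min(\alpha,\gamma)$. Then there is a $\mathbb{Z}_3\mathbb{Z}_9$-linear code $C$ of type $(\alpha,\beta;\gamma,\delta;\kappa)$ with $\mathrm{rank}(C)=r$ if and only if $$r\in\left\{\gamma+2\delta,\ldots,\min\left(\beta+\delta+\kappa,\ \gamma+\delta+\binom{\delta+1}{2}+\binom{\delta+2}{3}\right)\right\}.$$
   Context: A $\mathbb{Z}_3\mathbb{Z}_9$-additive code $\mathcal{C}$ is a subgroup of $\mathbb{Z}_3^\alpha\times\mathbb{Z}_9^\beta$. As an abelian group $\mathcal{C}\cong\mathbb{Z}_3^\gamma\times\mathbb{Z}_9^\delta$; if $\kappa$ is the $\mathbb{Z}_3$-dimension of the projection onto the first $\alpha$ coordinates of the subcode of codewords of order dividing $3$, then $\mathcal{C}$ has type $(\alpha,\beta;\gamma,\delta;\kappa)$. The Gray map $\phi:\mathbb{Z}_9\to\mathbb{Z}_3^3$ is $\phi(\theta)=\theta''(1,1,1)+\theta'(0,1,2)$ for $\theta=3\theta''+\theta'$, $\theta',\theta''\in\{0,1,2\}$, and $\Phi(\mathbf{x},\mathbf{y})=(\mathbf{x},\phi(y_1),\ldots,\phi(y_\beta))$. A $\mathbb{Z}_3\mathbb{Z}_9$-linear code of type $(\alpha,\beta;\gamma,\delta;\kappa)$ is $C=\Phi(\mathcal{C})$ for such a $\mathcal{C}$. $\mathrm{rank}(C)$ is the dimension over $\mathbb{Z}_3$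 of the linear span of $C$. *)

(* Defs.v *)
From HB Require Import structures.
From mathcomp Require Import all_boot all_order all_algebra.
Set Implicit Arguments. Unset Strict Implicit. Unset Printing Implicit Defensive.
Import GRing.Theory.
Local Open Scope ring_scope.

(* Z3 is modelled by 'F_3 (= Z/3Z, with its field structure), Z9 by 'Z_9. *)

Definition ambient (alpha beta : nat) : Type :=
  ('rV['F_3]_alpha * 'rV['Z_9]_beta)%type.

Definition is_additive_code (alpha beta : nat)
    (C : {set 'rV['F_3]_alpha * 'rV['Z_9]_beta}) : Prop :=
  0 \in C /\ (forall x y, x \in C -> y \in C -> x - y \in C).

Definition span_dim (n : nat) (S : {set 'rV['F_3]_n}) : nat :=
  \rank (\matrix_(i < #|S|) nth 0 (enum S) i).

Definition order3_subcode (alpha beta : nat)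
    (C : {set 'rV['F_3]_alpha * 'rV['Z_9]_beta}) :=
  [set c in C | c *+ 3 == 0].

Definition has_type (alpha beta : nat)
    (C : {set 'rV['F_3]_alpha * 'rV['Z_9]_beta}) (gamma delta kappa : nat) : Prop :=
  (exists f : 'rV['F_3]_gamma * 'rV['Z_9]_delta -> 'rV['F_3]_alpha * 'rV['Z_9]_beta,
      (forall a b, f (a + b) = f a + f b) /\ injective f /\ f @: setT = C)
  /\ span_dim [set c.1 | c in order3_subcode C] = kappa.

(* Gray map phi : Z_9 -> Z_3^3, phi(3t''+t') = t''(1,1,1) + t'(0,1,2). *)
Definition gray (t : 'Z_9) : 'rV['F_3]_3 :=
  \row_(j < 3) ((((t : nat) %/ 3)%:R : 'F_3) + ((t : nat) %% 3)%:R * (j : nat)%:R).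

Definition Gray (alpha beta : nat) (c : 'rV['F_3]_alpha * 'rV['Z_9]_beta)
    : 'rV['F_3]_(alpha + beta * 3) :=
  row_mx c.1 (mxvec (\matrix_(i < beta, j < 3) gray (c.2 0 i) 0 j)).

Definition is_linear_code_of_type (alpha beta gamma delta kappa : nat)
    (C : {set 'rV['F_3]_(alpha + beta * 3)}) : Prop :=
  exists Ca : {set 'rV['F_3]_alpha * 'rV['Z_9]_beta},
    is_additive_code Ca /\ has_type Ca gamma delta kappa /\ C = (@Gray alpha beta) @: Ca.

Definition code_rank (n : nat) (C : {set 'rV['F_3]_n}) : nat := span_dim C.

(* Main.v *)
Require Import Defs.
From HB Require Import structures.
From mathcomp Require Import all_boot all_order all_algebra.
From mathcomp Require Import zify ring.
Set Implicit Arguments. Unset Strict Implicit. Unset Printing Implicit Defensive.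
Import GRing.Theory.
Local Open Scope ring_scope.

(** Write [t = 3 hi + lo] for [t] in Z_9. The Gray map is linear in the digits [hi] and [lo],
    so the rank is that of the vectors [(x, hi y, lo y)].

    Upper bounds. The low digits are additive and span at most [delta] dimensions; a vector
    of the span with zero low digits has its first block in the projection of the order-3
    subcode, whence [beta + delta + kappa]. Moreover
    [hi (t + u) = hi t + hi u - (a^2 b + a b^2 + a b)] with [a = lo t] and [b = lo u], so the
    span is generated by the images of the [gamma + delta] generators and the products of two
    or three of the [delta] low-digit rows; counting multisets gives the second bound. The
    lower bound compares cardinalities.

    Existence. Besides identity blocks, use Z_9-columns [sum_x m_x u_x] with exponents [m] of
    weight at most 3. The functions [u |-> hi (sum_x m_x u_x)], over all [m <> 0] of weight
    at most 3, are linearly independent ([m = 3 e_l] being the low digit of [u_l]): finite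
    differences of a vanishing combination make all moments of degree at most 3 in the [m_x]
    vanish, and falling factorials then isolate the exponents by decreasing weight. Hence
    every additional column raises the rank by exactly one. *)

(** * Digits of Z_9 and their carry *)

Definition hi (t : 'Z_9) : 'F_3 := ((t : nat) %/ 3)%:R.
Definition lo (t : 'Z_9) : 'F_3 := ((t : nat) %% 3)%:R.

Lemma lo0 : lo 0 = 0. Proof. exact/val_inj. Qed.

Lemma loD t u : lo (t + u) = lo t + lo u.
Proof.
by case: t u => [[|[|[|[|[|[|[|[|[|//]]]]]]]]] ?] [[|[|[|[|[|[|[|[|[|//]]]]]]]]] ?];
   apply/val_inj.
Qed.

(** As a function on F_3, [-(a^2 b + a b^2 + a b)] is the carry of the digits a and b: 1 when their
    integer sum reaches 3, and 0 otherwise. All 81 cases are computed. *)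
Lemma hiD t u :
  hi (t + u) = hi t + hi u - (lo t * lo t * lo u + lo t * lo u * lo u + lo t * lo u).
Proof.
by case: t u => [[|[|[|[|[|[|[|[|[|//]]]]]]]]] ?] [[|[|[|[|[|[|[|[|[|//]]]]]]]]] ?];
   apply/val_inj.
Qed.

Lemma lo_eq0 t : (lo t == 0) = (t *+ 3 == 0).
Proof. by case: t => [[|[|[|[|[|[|[|[|[|//]]]]]]]]] ?]. Qed.

Lemma hi_lo_inj t u : hi t = hi u -> lo t = lo u -> t = u.
Proof.
by case: t u => [[|[|[|[|[|[|[|[|[|//]]]]]]]]] ?] [[|[|[|[|[|[|[|[|[|//]]]]]]]]] ?];
   move=> /(congr1 val) h /(congr1 val) l; apply/val_inj.
Qed.

Lemma natrF3 (x : 'F_3) : (x : nat)%:R = x.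
Proof. by rewrite natr_Zp. Qed.

Lemma scaleF3E (V : lmodType 'F_3) (x : 'F_3) (v : V) : x *: v = v *+ (x : nat).
Proof. by rewrite -scaler_nat natrF3. Qed.

(** * Spans *)

Section Span.
Variable n : nat.
Implicit Types (S : {set 'rV['F_3]_n}) (v : 'rV['F_3]_n).

Definition spanmx S := \matrix_(i < #|S|) nth 0 (enum S) i.

Lemma mem_spanmx S v : v \in S -> (v <= spanmx S)%MS.
Proof.
move=> vS; have lt : (index v (enum S) < #|S|)%N by rewrite cardE index_mem mem_enum.
have <- : row (Ordinal lt) (spanmx S) = v by rewrite rowK nth_index ?mem_enum.
exact: row_sub.
Qed.

Lemma spanmx_sub S m (B : 'M_(m, n)) :
  (forall v, v \in S -> (v <= B)%MS) -> (spanmx S <= B)%MS.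
Proof.
move=> h; apply/row_subP => i; rewrite rowK; apply: h.
by rewrite -mem_enum mem_nth // -cardE.
Qed.

(** Scalars of F_3 act as repeated addition, so closure under sums already covers all linear
    combinations. *)
Lemma spanmx_ind S (P : 'rV['F_3]_n -> Prop) :
    P 0 -> (forall u v, P u -> P v -> P (u + v)) -> (forall v, v \in S -> P v) ->
  forall v, (v <= spanmx S)%MS -> P v.
Proof.
move=> P0 PD PS v /submxP [u ->]; rewrite mulmx_sum_row.
elim/big_ind: _ => // i _; rewrite scaleF3E.
have Pi : P (row i (spanmx S)).
  by apply: PS; rewrite rowK -mem_enum mem_nth // -cardE.
by elim: (nat_of_ord (u 0 i)) => // k IH; rewrite mulrS; apply: PD.
Qed.

Lemma span_dim_le S m (B : 'M_(m, n)) :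
  (forall v, v \in S -> (v <= B)%MS) -> (span_dim S <= \rank B)%N.
Proof. by move=> h; apply/mxrankS/spanmx_sub. Qed.

Lemma card_le_span_dim S : (#|S| <= 3 ^ span_dim S)%N.
Proof.
pose g (u : 'rV['F_3]_(span_dim S)) := u *m row_base (spanmx S).
have sub : S \subset g @: setT.
  apply/subsetP => v /mem_spanmx; rewrite -(eq_row_base (spanmx S)) => /submxP [u ->].
  exact: imset_f.
apply: leq_trans (subset_leq_card sub) (leq_trans (leq_imset_card _ _) _).
by rewrite cardsT card_mx card_Fp ?mul1n.
Qed.

(** The [c i] act as linear functionals. Independence of their restrictions to [S] gives
    [spanmx S *m P] full column rank, which the rank of [spanmx S] must reach. *)
Lemma span_dim_ge S (I : finType) (c : I -> 'cV['F_3]_n) :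
    (forall d : I -> 'F_3,
       (forall v, v \in S -> \sum_i d i * (v *m c i) 0 0 = 0) -> forall i, d i = 0) ->
  (#|I| <= span_dim S)%N.
Proof.
move=> free; pose P := \matrix_(k < n, i < #|I|) c (enum_val i) k 0.
have vP (v : 'rV_n) i : (v *m P) 0 i = (v *m c (enum_val i)) 0 0.
  by rewrite !mxE; apply: eq_bigr => k _; rewrite mxE.
apply: leq_trans (mxrankM_maxl (spanmx S) P).
rewrite -mxrank_tr; apply: eq_leq; apply/esym/eqP/inj_row_free => d d0.
have H : forall i, d 0 (enum_rank i) = 0.
  apply: (free (fun i => d 0 (enum_rank i))) => v vS.
  have /submxP [u ev] := mem_spanmx vS.
  transitivity ((v *m P *m d^T) 0 0).
    rewrite mxE (reindex (@enum_val I predT)) /=; last first.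
      by exists enum_rank => x _; rewrite ?enum_valK ?enum_rankK.
    by apply: eq_bigr => i _; rewrite vP [d^T _ _]mxE enum_valK mulrC.
  have SPd : spanmx S *m P *m d^T = 0.
    by apply: trmx_inj; rewrite trmx_mul trmxK d0 trmx0.
  by rewrite ev -!mulmxA (mulmxA (spanmx S)) SPd mulmx0 mxE.
by apply/rowP => i; rewrite mxE -(H (enum_val i)) enum_valK.
Qed.

End Span.

Lemma span_dim_image n m (g : 'rV['F_3]_n -> 'rV['F_3]_m) (S : {set 'rV['F_3]_n}) :
  linear g -> (span_dim (g @: S) <= span_dim S)%N.
Proof.
move=> glin; pose gl : {linear 'rV['F_3]_n -> 'rV['F_3]_m} :=
  HB.pack g (GRing.isLinear.Build _ _ _ _ g glin).
apply: leq_trans (mxrankM_maxl (spanmx S) (lin1_mx gl)).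
apply: span_dim_le => _ /imsetP [v vS ->].
by rewrite -[g v](mul_rV_lin1 gl) submxMr ?mem_spanmx.
Qed.

(** * Digit coordinates *)

Section Digits.
Variables alpha beta : nat.
Local Notation amb := ('rV['F_3]_alpha * 'rV['Z_9]_beta)%type.
Implicit Types c : amb.

Definition hirow c : 'rV['F_3]_beta := map_mx hi c.2.
Definition lorow c : 'rV['F_3]_beta := map_mx lo c.2.
Definition digits c : 'rV['F_3]_(alpha + (beta + beta)) :=
  row_mx c.1 (row_mx (hirow c) (lorow c)).
Definition hiemb (h : 'rV['F_3]_beta) : 'rV['F_3]_(alpha + (beta + beta)) :=
  row_mx 0 (row_mx h 0).

Lemma digits_inj : injective digits.
Proof.
move=> [x y] [x' y'] /eq_row_mx [/= -> /eq_row_mx [/rowP h /rowP l]].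
congr (_, _); apply/rowP => i; apply: hi_lo_inj.
  by have := h i; rewrite !mxE.
by have := l i; rewrite !mxE.
Qed.

Definition gray_of_digits (v : 'rV['F_3]_(alpha + (beta + beta))) :
    'rV['F_3]_(alpha + beta * 3) :=
  row_mx (lsubmx v) (mxvec (\matrix_(i < beta, j < 3)
    (lsubmx (rsubmx v) 0 i + rsubmx (rsubmx v) 0 i * (j : nat)%:R))).

(** Digits h and l have the Gray block (h, h + l, h + 2l): entry 0 returns h, and entry 1 minus
    entry 0 returns l. *)
Definition digits_of_gray (v : 'rV['F_3]_(alpha + beta * 3)) :
    'rV['F_3]_(alpha + (beta + beta)) :=
  let A : 'M_(beta, 3) := vec_mx (rsubmx v) in
  row_mx (lsubmx v) (row_mx (\row_i A i 0) (\row_i (A i 1 - A i 0))).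

Lemma gray_of_digitsK c : gray_of_digits (digits c) = Gray c.
Proof.
rewrite /gray_of_digits /digits !(row_mxKl, row_mxKr) /Gray.
by congr (row_mx _ (mxvec _)); apply/matrixP => i j; rewrite !mxE.
Qed.

Lemma digits_of_grayK c : digits_of_gray (Gray c) = digits c.
Proof.
rewrite /digits_of_gray /Gray row_mxKl row_mxKr mxvecK.
congr (row_mx _ (row_mx _ _)); apply/rowP => i; rewrite !mxE /=.
  by rewrite mulr0 addr0.
by rewrite mulr0 addr0 mulr1 addrC addKr.
Qed.

Lemma gray_of_digits_linear : linear gray_of_digits.
Proof.
move=> a u v; rewrite /gray_of_digits !linearP /= scale_row_mx add_row_mx.
congr (row_mx _ _); apply/rowP => k; case/mxvec_indexP: k => i j.
by rewrite [RHS]mxE [X in _ = X + _]mxE !mxvecE !mxE; ring.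
Qed.

Lemma digits_of_gray_linear : linear digits_of_gray.
Proof.
move=> a u v; rewrite /digits_of_gray !linearP /= !scale_row_mx !add_row_mx.
congr (row_mx _ (row_mx _ _)); apply/rowP => i; rewrite !mxE //; ring.
Qed.

Lemma span_dim_Gray (C : {set amb}) :
  span_dim (@Gray alpha beta @: C) = span_dim (digits @: C).
Proof.
apply/eqP; rewrite eqn_leq; apply/andP; split.
  suff -> : @Gray alpha beta @: C = gray_of_digits @: (digits @: C).
    exact/span_dim_image/gray_of_digits_linear.
  by rewrite -imset_comp; apply: eq_imset => c /=; rewrite gray_of_digitsK.
suff -> : digits @: C = digits_of_gray @: (@Gray alpha beta @: C).
  exact/span_dim_image/digits_of_gray_linear.
by rewrite -imset_comp; apply: eq_imset => c /=; rewrite digits_of_grayK.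
Qed.

Lemma lorow0 : lorow 0 = 0.
Proof. by apply/rowP => i; rewrite !mxE lo0. Qed.

Lemma digits0 : digits 0 = 0.
Proof.
by rewrite /digits lorow0 (_ : hirow 0 = 0) ?row_mx0 //; apply/rowP => i; rewrite !mxE.
Qed.

Lemma lorowD c d : lorow (c + d) = lorow c + lorow d.
Proof. by apply/rowP => i; rewrite !mxE loD. Qed.

Definition rowmul (a b : 'rV['F_3]_beta) : 'rV['F_3]_beta := map2_mx *%R a b.

Lemma digitsD c d : let a := lorow c in let b := lorow d in
  digits (c + d) = digits c + digits d -
    (hiemb (rowmul (rowmul a a) b) + hiemb (rowmul (rowmul a b) b) + hiemb (rowmul a b)).
Proof.
rewrite /= /digits /hiemb lorowD !(add_row_mx, opp_row_mx, addr0, subr0, oppr0).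
congr (row_mx _ (row_mx _ _)).
by apply/rowP => i; rewrite !mxE hiD.
Qed.

(** Tripling always kills the F_3 block, and kills a Z_9 entry exactly when its low digit is 0. The
    order-3 subcode is thus the part of the code with zero low digits. *)
Lemma lorow_eq0 c : lorow c = 0 <-> c *+ 3 = 0.
Proof.
have E : c *+ 3 = (c.1 *+ 3, c.2 *+ 3) by case: c => x y; rewrite !mulrS.
have x0 : c.1 *+ 3 = 0.
  by apply/rowP => i; rewrite mulmxnE mxE; case: (c.1 0 i) => [[|[|[|//]]] ?]; apply/val_inj.
rewrite E x0; split=> [/rowP h | [/rowP h]].
  congr (_, _); apply/rowP => i; rewrite mulmxnE mxE; apply/eqP; rewrite -lo_eq0.
  by have := h i; rewrite !mxE => ->.
apply/rowP => i; rewrite !mxE; apply/eqP; rewrite lo_eq0.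
by have := h i; rewrite mulmxnE mxE => ->.
Qed.

End Digits.

(** * Upper bounds *)

Lemma rowZ9_ind n (P : 'rV['Z_9]_n -> Prop) :
    P 0 -> (forall u v, P u -> P v -> P (u + v)) -> (forall j, P (delta_mx 0 j)) ->
  forall v, P v.
Proof.
move=> P0 PD Pd v; rewrite [v]row_sum_delta; elim/big_ind: _ => // j _.
rewrite -[v 0 j]natr_Zp scaler_nat.
by elim: (nat_of_ord _) => // k IH; rewrite mulrS; apply: PD.
Qed.

Lemma rowF3_ind n (P : 'rV['F_3]_n -> Prop) :
    P 0 -> (forall u v, P u -> P v -> P (u + v)) -> (forall j, P (delta_mx 0 j)) ->
  forall v, P v.
Proof.
move=> P0 PD Pd v; rewrite [v]row_sum_delta; elim/big_ind: _ => // j _.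
by rewrite scaleF3E; elim: (nat_of_ord _) => // k IH; rewrite mulrS; apply: PD.
Qed.

Lemma pairD (U V : zmodType) (a b : U) (c d : V) : (a, c) + (b, d) = (a + b, c + d).
Proof. by []. Qed.

Lemma message_ind g d (P : 'rV['F_3]_g * 'rV['Z_9]_d -> Prop) :
    P 0 -> (forall u v, P u -> P v -> P (u + v)) ->
    (forall i, P (delta_mx 0 i, 0)) -> (forall j, P (0, delta_mx 0 j)) ->
  forall z, P z.
Proof.
move=> P0 PD Pg Pd [x y].
have -> : (x, y) = (x, 0) + (0, y) by rewrite pairD addr0 add0r.
apply: (PD).
  elim/rowF3_ind: x => // u v Pu Pv.
  have -> : (u + v, 0) = (u, 0) + (v, 0) :> 'rV['F_3]_g * 'rV['Z_9]_d.
    by rewrite pairD addr0.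
  exact: PD.
elim/rowZ9_ind: y => // u v Pu Pv.
have -> : (0, u + v) = (0, u) + (0, v) :> 'rV['F_3]_g * 'rV['Z_9]_d.
  by rewrite pairD addr0.
exact: PD.
Qed.

(** Used to prove membership of a multilinear expression by reducing one argument at a time to the
    rows of a generating matrix. *)
Lemma linear_submx m n p k (A : 'M['F_3]_(m, n)) (W : 'M['F_3]_(k, p))
    (g : 'rV_n -> 'rV_p) :
    linear g -> (forall i, (g (row i A) <= W)%MS) ->
  forall v : 'rV_n, (v <= A)%MS -> (g v <= W)%MS.
Proof.
move=> glin gA v /submxP [u ->]; rewrite mulmx_sum_row.
have g0 : g 0 = 0 by have := glin (-1) 0 0; rewrite scaler0 addr0 scaleN1r addNr.
elim/big_ind: _ => [|a b ga gb|i _]; first by rewrite g0 sub0mx.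
  by rewrite -[a]scale1r glin scale1r addmx_sub.
by rewrite -[_ *: _]addr0 glin g0 addr0 scalemx_sub.
Qed.

Section UpperBounds.
Variables alpha beta gamma delta : nat.
Local Notation amb := ('rV['F_3]_alpha * 'rV['Z_9]_beta)%type.
Variable f : 'rV['F_3]_gamma * 'rV['Z_9]_delta -> amb.
Hypothesis fD : forall a b, f (a + b) = f a + f b.
Let C := f @: setT.

Let f0 : f 0 = 0.
Proof. by apply: (addIr (f 0)); rewrite -fD addr0 add0r. Qed.

Let CD c d : c \in C -> d \in C -> c + d \in C.
Proof.
by move=> /imsetP [a _ ->] /imsetP [b _ ->]; rewrite -fD imset_f.
Qed.

Let lowmx := \matrix_(j < delta) lorow (f (0, delta_mx 0 j)).

Let lorow_f_gamma i : lorow (f (delta_mx 0 i, 0)) = 0.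
Proof.
apply/lorow_eq0; set z := (_, _); have : z *+ 3 = 0.
  rewrite !mulrS mulr0n addr0 !pairD !addr0; congr (_, _).
  by apply/rowP => k; rewrite !mxE; case: (k == i) => //; apply/val_inj.
by rewrite !mulrS !mulr0n !addr0 -!fD => ->.
Qed.

Lemma lorow_code c : c \in C -> (lorow c <= lowmx)%MS.
Proof.
case/imsetP => z _ ->; elim/message_ind: z => [|u v Pu Pv|i|j].
- by rewrite f0 lorow0 sub0mx.
- by rewrite fD lorowD addmx_sub.
- by rewrite lorow_f_gamma sub0mx.
by have <- : row j lowmx = lorow (f (0, delta_mx 0 j)); [rewrite rowK | apply: row_sub].
Qed.

Lemma hiemb_linear a b : linear (fun h => hiemb alpha (rowmul (rowmul a b) h : 'rV_beta)).
Proof.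
move=> k u v; rewrite /hiemb !scale_row_mx !add_row_mx !scaler0 !addr0.
by congr (row_mx _ (row_mx _ _)); apply/rowP => p; rewrite !mxE; ring.
Qed.

(* On the span, the low digits and the first block are those of a codeword, so the
   kernel of the low digits meets the first block only in the order-3 subcode. *)
Lemma rank_le_hirow m (B : 'M['F_3]_(m, beta)) :
    (forall c, c \in C -> (hirow c <= B)%MS) ->
  (span_dim (@digits alpha beta @: C)
     <= delta + span_dim [set c.1 | c in order3_subcode C] + \rank B)%N.
Proof.
move=> CB; set S := (@digits alpha beta) @: C; set X := [set c.1 | c in _].
pose L : 'M['F_3]_(alpha + (beta + beta), beta) := col_mx 0 (col_mx 0 1%:M).
have vL (v : 'rV_(alpha + (beta + beta))) : v *m L = rsubmx (rsubmx v).
  by rewrite -{1}[v]hsubmxK -{1}[rsubmx v]hsubmxK !mul_row_col !mulmx0 mulmx1 !add0r.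
(* Because of carries the high digits of [v] may differ from those of [c]; for them only membership
   in [B] is kept. *)
have repr (v : 'rV_(alpha + (beta + beta))) : (v <= spanmx S)%MS ->
    (exists2 c, c \in C & c.1 = lsubmx v /\ lorow c = rsubmx (rsubmx v))
    /\ (lsubmx (rsubmx v) <= B)%MS.
  elim/spanmx_ind => {v} [|u v [[c cC [c1 c2]] cB] [[d dC [d1 d2]] dB]|_ /imsetP [c cC ->]].
  - split; last by rewrite !linear0 sub0mx.
    exists 0; first by rewrite -f0 imset_f.
    by rewrite !linear0 lorow0.
  - split; last by rewrite !linearD addmx_sub.
    exists (c + d); first exact: CD.
    split; first by rewrite [RHS]linearD /= -c1 -d1.
    by rewrite lorowD [rsubmx (u + v)]linearD [RHS]linearD c2 d2.
  rewrite /digits row_mxKl row_mxKr row_mxKl row_mxKr; split; last exact: CB.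
  by exists c.
(* Rank-nullity for [L]: the image lies in the row space of [lowmx], of rank at most [delta]; the
   kernel is placed inside [A + H]. *)
rewrite /span_dim -/(spanmx S) -(mxrank_mul_ker _ L) -addnA; apply: leq_add.
  apply: leq_trans (rank_leq_row lowmx); apply/mxrankS/row_subP => i.
  rewrite row_mul vL; have [[c cC [_ <-]] _] := repr _ (row_sub i _).
  exact: lorow_code.
pose A := spanmx X *m (row_mx 1%:M 0 : 'M_(alpha, alpha + (beta + beta))).
pose H := B *m (row_mx 0 (row_mx 1%:M 0) : 'M_(beta, alpha + (beta + beta))).
apply: (@leq_trans (\rank (A + H)%MS)); last first.
  apply: leq_trans (mxrank_adds_leqif A H) _.
  by apply: leq_add; exact: mxrankM_maxl.
apply/mxrankS/row_subP => i; set v := row i _.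
have : (v <= spanmx S :&: kermx L)%MS by apply: row_sub.
rewrite sub_capmx => /andP [/repr [[c cC [c1 c2]] vB] /sub_kermxP].
rewrite vL => v0; rewrite v0 in c2.
have -> : v = lsubmx v *m row_mx 1%:M 0 + lsubmx (rsubmx v) *m row_mx 0 (row_mx 1%:M 0).
  rewrite !mul_mx_row !mulmx0 !mulmx1 add_row_mx addr0 add0r.
  by rewrite -[0 in RHS]v0 !hsubmxK.
apply: addmx_sub_adds; last exact: submxMr.
apply/submxMr/mem_spanmx/imsetP; exists c => //.
by rewrite inE cC; apply/eqP/lorow_eq0.
Qed.

Definition lowmono (s : seq 'I_delta) : 'rV['F_3]_(alpha + (beta + beta)) :=
  hiemb alpha (\row_p \prod_(j <- s) lowmx j p).

(** Sorted tuples stand for multisets of generators: by commutativity each product of low-digit rows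
    depends only on the multiset. *)
Definition sorted_tuples k := [set t : k.-tuple 'I_delta | sorted leq (map val t)].

Definition monomx k : 'M['F_3]_(#|sorted_tuples k|, _) :=
  \matrix_(q < #|sorted_tuples k|) lowmono (enum_val q).

Lemma lowmono_sub s : (lowmono s <= monomx (size s))%MS.
Proof.
pose r (i j : 'I_delta) := (i <= j)%N.
have sz : size (sort r s) == size s by rewrite size_sort.
have ht : Tuple sz \in sorted_tuples (size s).
  rewrite inE /= sorted_map; apply: sort_sorted => i j; exact: leq_total.
have -> : lowmono s = row (enum_rank_in ht (Tuple sz)) (monomx (size s)).
  rewrite rowK enum_rankK_in //; congr hiemb; apply/rowP => p; rewrite !mxE.
  by apply: perm_big; rewrite perm_sym /= perm_sort.
exact: row_sub.
Qed.

Lemma rank_le_monomials : (0 < delta)%N ->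
  (span_dim (@digits alpha beta @: C)
     <= gamma + delta + 'C(delta + 1, 2) + 'C(delta + 2, 3))%N.
Proof.
move=> d_gt0.
have cards k : (0 < k)%N -> #|sorted_tuples k| = 'C(delta + k.-1, k).
  rewrite /sorted_tuples; case: (delta) d_gt0 => // n _ k0.
  by rewrite card_sorted_tuples; congr 'C(_, _); lia.
pose U := \matrix_(i < gamma) digits (f (delta_mx 0 i, 0)).
pose V := \matrix_(j < delta) digits (f (0, delta_mx 0 j)).
pose W := (U + V + monomx 2 + monomx 3)%MS.
apply: (@leq_trans (\rank W)); last first.
  rewrite -(cards 2) // -(cards 3) //.
  do 3! (apply: leq_trans (mxrank_adds_leqif _ _) _; apply: leq_add;
    last exact: rank_leq_row).
  exact: rank_leq_row.
have W2 : (monomx 2 <= W)%MS by rewrite /W -addsmxA addsmxC -addsmxA addsmxSl.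
have W3 : (monomx 3 <= W)%MS by rewrite /W addsmxSr.
(* Padding with the all-ones row turns a product of two rows into one of three, so [hiemb_linear]
   serves both degrees. *)
have quad a b : (a <= lowmx)%MS -> (b <= lowmx)%MS -> (hiemb alpha (rowmul a b) <= W)%MS.
  move=> la lb; suff : (hiemb alpha (rowmul (rowmul (const_mx 1) a) b) <= W)%MS.
    by congr (hiemb _ _ <= _)%MS; apply/rowP => p; rewrite !mxE mul1r.
  move: b lb; apply: linear_submx => [|j]; first exact: hiemb_linear.
  suff : (hiemb alpha (rowmul (rowmul (const_mx 1) (row j lowmx)) a) <= W)%MS.
    by congr (hiemb _ _ <= _)%MS; apply/rowP => p; rewrite !mxE; ring.
  move: a la; apply: linear_submx => [|i]; first exact: hiemb_linear.
  apply: submx_trans W2; apply: submx_trans (lowmono_sub [:: j; i]).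
  suff -> : rowmul (rowmul (const_mx 1) (row j lowmx)) (row i lowmx)
    = \row_p \prod_(j <- [:: j; i]) lowmx j p by [].
  by apply/rowP => p; rewrite !mxE !big_cons big_nil mulr1 !mxE mul1r.
(* Commutativity rotates each argument in turn into the last slot, where linearity reduces it to a
   row of [lowmx]. *)
have cub a b c : (a <= lowmx)%MS -> (b <= lowmx)%MS -> (c <= lowmx)%MS ->
    (hiemb alpha (rowmul (rowmul a b) c) <= W)%MS.
  move=> la lb; move: c; apply: linear_submx => [|k]; first exact: hiemb_linear.
  suff : (hiemb alpha (rowmul (rowmul a (row k lowmx)) b) <= W)%MS.
    by congr (hiemb _ _ <= _)%MS; apply/rowP => p; rewrite !mxE; ring.
  move: b lb; apply: linear_submx => [|j]; first exact: hiemb_linear.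
  suff : (hiemb alpha (rowmul (rowmul (row k lowmx) (row j lowmx)) a) <= W)%MS.
    by congr (hiemb _ _ <= _)%MS; apply/rowP => p; rewrite !mxE; ring.
  move: a la; apply: linear_submx => [|i]; first exact: hiemb_linear.
  apply: submx_trans W3; apply: submx_trans (lowmono_sub [:: k; j; i]).
  suff -> : rowmul (rowmul (row k lowmx) (row j lowmx)) (row i lowmx)
    = \row_p \prod_(j <- [:: k; j; i]) lowmx j p by [].
  by apply/rowP => p; rewrite !mxE !big_cons big_nil mulr1 !mxE mulrA.
apply: span_dim_le => _ /imsetP [_ /imsetP [z _ ->] ->].
(* The generators lie in [U] and [V]; a sum of messages adds only carry terms, which [quad] and
   [cub] place in [W]. *)
elim/message_ind: z => [|u v Pu Pv|i|j].
- by rewrite f0 digits0 sub0mx.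
- have [lu lv] : (lorow (f u) <= lowmx)%MS /\ (lorow (f v) <= lowmx)%MS.
    by split; apply: lorow_code; exact: imset_f.
  rewrite fD digitsD; apply: addmx_sub; first exact: addmx_sub.
  by rewrite eqmx_opp; do 2?[apply: addmx_sub]; [exact: cub | exact: cub | exact: quad].
- have <- : row i U = digits (f (delta_mx 0 i, 0)) by rewrite rowK.
  by rewrite /W -!addsmxA (submx_trans (row_sub _ _)) ?addsmxSl.
have <- : row j V = digits (f (0, delta_mx 0 j)) by rewrite rowK.
by rewrite (submx_trans (row_sub _ _)) // /W -addsmxA (submx_trans _ (addsmxSl _ _)) ?addsmxSr.
Qed.

End UpperBounds.

(** * Independence of the column functions *)

Lemma lo_nat a : lo a%:R = a%:R.
Proof. by elim: a => [|a IH]; rewrite ?lo0 // !mulrS loD IH; congr (_ + _); apply/val_inj. Qed.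

Lemma hi_natD a b : hi (a + b)%:R =
  hi a%:R + hi b%:R - (a%:R * a%:R * b%:R + a%:R * b%:R * b%:R + a%:R * b%:R).
Proof. by rewrite natrD hiD !lo_nat. Qed.

Lemma hi_mul3 t : hi (t *+ 3) = lo t.
Proof. by case: t => [[|[|[|[|[|[|[|[|[|//]]]]]]]]] ?]; apply/val_inj. Qed.

Lemma threeF3 : 3%:R = 0 :> 'F_3. Proof. exact/val_inj. Qed.

(** Iterated, this writes an exponent vector of weight k as a sum of k unit vectors. *)
Lemma sum_peel n k (s : 'I_n -> nat) : (\sum_x s x = k.+1)%N ->
  exists i s', (forall x, s x = (x == i) + s' x)%N /\ (\sum_x s' x = k)%N.
Proof.
move=> sk; have [i si|s0] := pickP (fun i => 0 < s i)%N; last first.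
  by move: sk; rewrite big1 // => i _; have := s0 i; case: (s i).
have sE x : (s x = (x == i) + (s x - (x == i)))%N by case: eqP => [->|_]; lia.
exists i, (fun x => s x - (x == i))%N; split=> //.
suff : (\sum_x s x = 1 + \sum_x (s x - (x == i)))%N by rewrite sk => -[].
rewrite (eq_bigr _ (fun x _ => sE x)) big_split /=; congr addn.
by rewrite (bigD1 i) //= eqxx big1 // => x /negbTE ->.
Qed.

Lemma sum_le_eq n (s t : 'I_n -> nat) : (forall x, t x <= s x)%N ->
  (\sum_x s x <= \sum_x t x)%N -> s =1 t.
Proof.
move=> ts le x; have := leqif_sum (fun i (_ : true) => leqif_eq (ts i)).
by move/geq_leqif; rewrite le => /esym/forallP/(_ x)/eqP.
Qed.

(** Each repetition of an index excludes one more value, starting from 0, so the entry is at least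
    the number of its occurrences among i, k, l. *)
Lemma dominate3 n (s : 'I_n -> nat) i k l :
    s i != 0%N -> s k != (k == i) -> s l != ((l == i) + (l == k))%N ->
  forall x, ((x == i) + (x == k) + (x == l) <= s x)%N.
Proof.
move=> si sk sl x; move: si sk sl.
by case: (eqVneq x l) => [<-|_]; case: (eqVneq x k) => [<-|_];
   case: (eqVneq x i) => [<-|_]; rewrite ?eqxx; lia.
Qed.

Lemma dominate2 n (s : 'I_n -> nat) i k :
  s i != 0%N -> s k != (k == i) -> forall x, ((x == i) + (x == k) <= s x)%N.
Proof.
move=> si sk x; move: si sk.
by case: (eqVneq x k) => [<-|_]; case: (eqVneq x i) => [<-|_]; rewrite ?eqxx; lia.
Qed.

Section ColumnFree.
Variables (J : finType) (n : nat) (m : J -> 'I_n -> nat) (d : J -> 'F_3).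
Hypothesis m_weight : forall j, (0 < \sum_x m j x <= 3)%N.
Hypothesis m_inj : forall j j', m j =1 m j' -> j = j'.
Hypothesis d_null : forall u : 'rV['Z_9]_n, \sum_j d j * hi (\sum_x u 0 x *+ m j x) = 0.

Let E (g : J -> 'F_3) := \sum_j d j * g j.

(** [d_null] is evaluated at the sum of the unit vectors listed in [w], where column j takes the
    value of the sum of the [m j i]. *)
Let E_hi w : E (fun j => hi (\sum_(i <- w) m j i)%:R) = 0.
Proof.
rewrite -[RHS](d_null (\sum_(i <- w) delta_mx 0 i)); apply: eq_bigr => j _.
congr (_ * hi _); rewrite natr_sum.
under [RHS]eq_bigr => x _ do rewrite summxE -sumrMnl.
rewrite exchange_big /=; apply: eq_bigr => i _.
rewrite (bigD1 i) //= big1 ?addr0 ?mxE ?eqxx // => x /negbTE ne.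
by rewrite mxE ne andbF mul0rn.
Qed.

Let E_hi1 i : E (fun j => hi (m j i)%:R) = 0.
Proof. by rewrite -(E_hi [:: i]); apply: eq_bigr => j _; rewrite big_seq1. Qed.

Let E_hi2 i k : E (fun j => hi (m j i + m j k)%:R) = 0.
Proof. by rewrite -(E_hi [:: i; k]); apply: eq_bigr => j _; rewrite big_cons big_seq1. Qed.

Let E_hi3 i k l : E (fun j => hi (m j i + m j k + m j l)%:R) = 0.
Proof.
by rewrite -(E_hi [:: i; k; l]); apply: eq_bigr => j _; rewrite !big_cons big_nil addn0 addnA.
Qed.

(** The high digit of 3a is the low digit of a, so repeating an index three times yields the first
    moment. *)
Let E1 i : E (fun j => (m j i)%:R) = 0.
Proof.
rewrite -(E_hi3 i i i); apply: eq_bigr => j _; congr (_ * _).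
by rewrite -[in LHS]lo_nat -hi_mul3 -mulrnA; congr (hi _%:R); lia.
Qed.

(** The third finite difference of [hi] leaves only the mixed term of the carry, -2abc, which equals
    abc in F_3. *)
Let E3 i k l : E (fun j => (m j i)%:R * (m j k)%:R * (m j l)%:R) = 0.
Proof.
transitivity (E (fun j => hi (m j i + m j k + m j l)%:R) - E (fun j => hi (m j i + m j k)%:R)
  - E (fun j => hi (m j i + m j l)%:R) - E (fun j => hi (m j k + m j l)%:R)
  + E (fun j => hi (m j i)%:R) + E (fun j => hi (m j k)%:R) + E (fun j => hi (m j l)%:R)).
  rewrite /E -!sumrB -!big_split /=; apply: eq_bigr => j _.
  rewrite !hi_natD natrD; set a := (m j i)%:R; set b := (m j k)%:R; set c := (m j l)%:R.
  (* Subtracting 3abc, which is 0 in F_3, turns abc into -2abc, and the identity then holds in any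
     commutative ring. *)
  rewrite -[LHS]subr0 -(mul0r (d j * a * b * c)) -threeF3.
  by set h := hi _; set h' := hi _; set h'' := hi _; ring.
by rewrite E_hi3 !E_hi2 !E_hi1 !subr0 !addr0.
Qed.

Let E2 i k : E (fun j => (m j i)%:R * (m j k)%:R) = 0.
Proof.
transitivity (E (fun j => hi (m j i)%:R) + E (fun j => hi (m j k)%:R)
  - E (fun j => hi (m j i + m j k)%:R) - E (fun j => (m j i)%:R * (m j i)%:R * (m j k)%:R)
  - E (fun j => (m j i)%:R * (m j k)%:R * (m j k)%:R)).
  rewrite /E -!big_split -!sumrB /=; apply: eq_bigr => j _; rewrite !hi_natD.
  by set h := hi _; set h' := hi _; ring.
by rewrite E_hi2 !E_hi1 !E3 !subr0 !addr0.
Qed.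

Let weight j := (\sum_x m j x)%N.

Let m_le j x : (m j x <= weight j)%N.
Proof. by rewrite /weight (bigD1 x) //= leq_addr. Qed.

(* Triangularity: [g] is supported on the exponents that dominate [m j0], and on those of
   larger weight the coefficients are already known to vanish. *)
Let separate j0 (g : J -> 'F_3) :
    (forall j, (weight j0 < weight j)%N -> d j = 0) -> E g = 0 -> g j0 != 0 ->
    (forall j, g j != 0 -> forall x, (m j0 x <= m j x)%N) ->
  d j0 = 0.
Proof.
move=> high Eg gj0 dom; apply/eqP; have /eqP := Eg.
rewrite /E (bigD1 j0) //= big1 => [|j ne].
  by rewrite addr0 mulf_eq0 (negbTE gj0) orbF.
have [/high ->|le] := ltnP (weight j0) (weight j); first by rewrite mul0r.
have [->|gj] := eqVneq (g j) 0; first by rewrite mulr0.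
by case/eqP: ne; apply: m_inj; apply: sum_le_eq => //; apply: dom.
Qed.

Lemma column_free j : d j = 0.
Proof.
have w1 j' : (weight j' <= 3)%N by case/andP: (m_weight j').
have m3 j' x : (m j' x <= 3)%N := leq_trans (m_le j' x) (w1 j').
have d3 j0 : weight j0 = 3 -> d j0 = 0.
  move=> w3; have high j' : (weight j0 < weight j')%N -> d j' = 0 by have := w1 j'; lia.
  have [i [s1 [e1 /sum_peel [k [s2 [e2 /sum_peel [l [s3 [e3 z]]]]]]]]] := sum_peel w3.
  have mE x : m j0 x = ((x == i) + (x == k) + (x == l))%N.
    rewrite e1 e2 e3; suff -> : s3 x = 0%N by lia.
    by move/eqP: z; rewrite sum_nat_eq0 => /forallP/(_ x)/eqP.
  (* For the exponent 3 e_i the falling factorial takes the value 3! = 0 in F_3. The high digit of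
     [m j i] replaces it: among the entries 0 to 3 it is nonzero only at 3. *)
  have [/andP [/eqP ki /eqP li]|ne] := boolP ((k == i) && (l == i)).
    subst k l; apply: (separate high (E_hi1 i)); first by rewrite mE eqxx.
    move=> j' gj x; have : m j' i = 3.
      by move: gj (m3 j' i); case: (m j' i) => [|[|[|[|]]]].
    by rewrite mE => mi; case: (eqVneq x i) => [->|_] //; rewrite mi.
  (* The test function is a falling factorial; [c] counts the earlier occurrences of l. Its value at
     [j0] is 1 or 2, hence nonzero. *)
  pose c := (l == i)%:R + (l == k)%:R : 'F_3.
  apply: (@separate j0 (fun j => (m j i)%:R * ((m j k)%:R - (k == i)%:R) * ((m j l)%:R - c)))
    => //.
  - transitivity (E (fun j => (m j i)%:R * (m j k)%:R * (m j l)%:R)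
      - c * E (fun j => (m j i)%:R * (m j k)%:R)
      - (k == i)%:R * E (fun j => (m j i)%:R * (m j l)%:R)
      + (k == i)%:R * c * E (fun j => (m j i)%:R)).
      rewrite /E !mulr_sumr -!sumrB -!big_split /=; apply: eq_bigr => j' _.
      by set b := (k == i)%:R; ring.
    by rewrite E3 !E2 E1 !mulr0 !subr0 addr0.
  - move: ne; rewrite !mE /c !eqxx (eq_sym i k) (eq_sym i l) (eq_sym k l).
    case: (eqVneq l k) => [->|_]; first by case: (eqVneq k i).
    by case: (eqVneq k i); case: (eqVneq l i).
  move=> j'; rewrite !mulf_eq0 !negb_or => /andP [/andP [gi gk] gl] x; rewrite mE.
  apply: dominate3; first by apply: contraNneq gi => ->.
    by apply: contraNneq gk => ->; rewrite subrr.
  by apply: contraNneq gl => ->; rewrite natrD subrr.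
have d2 j0 : weight j0 = 2 -> d j0 = 0.
  move=> w2; have high j' : (weight j0 < weight j')%N -> d j' = 0.
    by have := w1 j'; move=> ? ?; apply: d3; lia.
  have [i [s1 [e1 /sum_peel [k [s2 [e2 z]]]]]] := sum_peel w2.
  have mE x : m j0 x = ((x == i) + (x == k))%N.
    rewrite e1 e2; suff -> : s2 x = 0%N by lia.
    by move/eqP: z; rewrite sum_nat_eq0 => /forallP/(_ x)/eqP.
  apply: (@separate j0 (fun j => (m j i)%:R * ((m j k)%:R - (k == i)%:R))) => //.
  - transitivity (E (fun j => (m j i)%:R * (m j k)%:R) - (k == i)%:R * E (fun j => (m j i)%:R)).
      rewrite /E !mulr_sumr -!sumrB /=; apply: eq_bigr => j' _.
      by set b := (k == i)%:R; ring.
    by rewrite E2 E1 mulr0 subr0.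
  - by rewrite !mE !eqxx (eq_sym i k); case: (eqVneq k i).
  move=> j'; rewrite !mulf_eq0 !negb_or => /andP [gi gk] x; rewrite mE.
  apply: dominate2; first by apply: contraNneq gi => ->.
  by apply: contraNneq gk => ->; rewrite subrr.
have [w3|w2|w1j] : [\/ weight j = 3, weight j = 2 | weight j = 1]%N.
- have := m_weight j; rewrite -/(weight j).
  by case: (weight j) => [|[|[|[|]]]] // _; [apply: Or33 | apply: Or32 | apply: Or31].
- exact: d3.
- exact: d2.
have high j' : (weight j < weight j')%N -> d j' = 0.
  move=> lt; have [/d2|/d3] // : weight j' = 2 \/ weight j' = 3 by have := w1 j'; lia.
have [i [s1 [e1 z]]] := sum_peel w1j.
have mE x : m j x = (x == i).
  rewrite e1; suff -> : s1 x = 0%N by lia.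
  by move/eqP: z; rewrite sum_nat_eq0 => /forallP/(_ x)/eqP.
apply: (separate high (E1 i)); first by rewrite mE eqxx.
move=> j' gj x; rewrite mE; case: eqVneq => // ->.
by rewrite lt0n; apply: contraNneq gj => ->.
Qed.

End ColumnFree.

(** * Construction *)

Definition three (x : 'F_3) : 'Z_9 := ((x : nat) * 3)%:R.

Lemma threeD x y : three (x + y) = three x + three y.
Proof. by case: x y => [[|[|[|//]]] ?] [[|[|[|//]]] ?]; apply/val_inj. Qed.

Lemma hi_three x : hi (three x) = x.
Proof. by case: x => [[|[|[|//]]] ?]; apply/val_inj. Qed.

Lemma lo_three x : lo (three x) = 0.
Proof. by case: x => [[|[|[|//]]] ?]; apply/val_inj. Qed.

Lemma three_inj : injective three.
Proof. exact: can_inj hi_three. Qed.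

Section Construction.
Variables kappa alpha' gamma' delta e beta' : nat.
Variables (m : 'I_e -> 'I_delta -> nat) (sel : 'I_delta -> 'I_e).
Hypothesis m_weight : forall q, (0 < \sum_x m q x <= 3)%N.
Hypothesis m_inj : forall q q', m q =1 m q' -> q = q'.
Hypothesis m_sel : forall l x, m (sel l) x = (x == l).
(** A column 3 u_l would have as high digit the low digit of u_l, a coordinate already counted among
    the [delta] low ones. *)
Hypothesis m_neq3 : forall q l, ~ (m q =1 fun x => (x == l) * 3)%N.

Local Notation alpha := (kappa + alpha')%N.
Local Notation gamma := (kappa + gamma')%N.
Local Notation beta := (gamma' + (e + beta'))%N.

Definition columns (u : 'rV['Z_9]_delta) : 'rV['Z_9]_e :=
  \row_q \sum_x u 0 x *+ m q x.

Definition encode (z : 'rV['F_3]_gamma * 'rV['Z_9]_delta) : 'rV['F_3]_alpha * 'rV['Z_9]_beta :=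
  (row_mx (lsubmx z.1) 0, row_mx (map_mx three (rsubmx z.1)) (row_mx (columns z.2) 0)).

Definition code := encode @: setT.

Lemma columnsD u v : columns (u + v) = columns u + columns v.
Proof.
apply/rowP => q; rewrite !mxE -big_split; apply: eq_bigr => x _.
by rewrite mxE mulrnDl.
Qed.

Lemma columns_sel u l : columns u 0 (sel l) = u 0 l.
Proof.
rewrite mxE (bigD1 l) //= big1 ?m_sel ?eqxx ?addr0 // => x /negbTE ne.
by rewrite m_sel ne.
Qed.

Lemma columns0 : columns 0 = 0.
Proof. by apply: (addIr (columns 0)); rewrite -columnsD addr0 add0r. Qed.

Lemma hi0 : hi 0 = 0. Proof. exact/val_inj. Qed.

Lemma digits_encode z : digits (encode z) =
  row_mx (row_mx (lsubmx z.1) 0)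
    (row_mx (row_mx (rsubmx z.1) (row_mx (map_mx hi (columns z.2)) 0))
            (row_mx 0 (row_mx (map_mx lo (columns z.2)) 0))).
Proof.
rewrite /digits /hirow /lorow /= !map_row_mx.
by congr (row_mx _ (row_mx (row_mx _ (row_mx _ _)) (row_mx _ (row_mx _ _))));
  apply/rowP => i; rewrite ?mxE ?hi_three ?lo_three ?hi0 ?lo0 ?mxE.
Qed.

Lemma encodeD a b : encode (a + b) = encode a + encode b.
Proof.
rewrite /encode pairD !add_row_mx !addr0 columnsD !linearD.
by congr (_, row_mx _ _); apply/rowP => i; rewrite !mxE threeD.
Qed.

Lemma encode_inj : injective encode.
Proof.
move=> [x u] [y v] [] /eq_row_mx [/= exl _] /eq_row_mx [/rowP exr /eq_row_mx [/rowP euv _]].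
congr (_, _); last by apply/rowP => l; rewrite -!columns_sel euv.
rewrite -[x]hsubmxK -[y]hsubmxK exl; congr row_mx.
by apply/rowP => i; apply: three_inj; have := exr i; rewrite !mxE.
Qed.

Lemma code_additive : is_additive_code code.
Proof.
have e0 : encode 0 = 0 by apply: (addIr (encode 0)); rewrite -encodeD addr0 add0r.
split; first by rewrite -e0 imset_f.
move=> _ _ /imsetP [a _ ->] /imsetP [b _ ->].
suff -> : encode a - encode b = encode (a - b) by rewrite imset_f.
by apply: (addIr (encode b)); rewrite -encodeD !subrK.
Qed.

Lemma span_dim_order3 : span_dim [set c.1 | c in order3_subcode code] = kappa.
Proof.
pose B : 'M['F_3]_(kappa, alpha) := row_mx 1%:M 0.
have rB : \rank B = kappa.
  apply/eqP/row_freeP; exists (col_mx 1%:M 0).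
  by rewrite mul_row_col mul0mx addr0 mul1mx.
transitivity (\rank B) => //; apply/eqP; rewrite eqn_leq; apply/andP; split.
  apply: span_dim_le => v /imsetP [c].
  rewrite inE => /andP [/imsetP [z _ ->] _] ->.
  by rewrite -[(encode z).1]/(row_mx (lsubmx z.1) 0) -[lsubmx _]mulmx1 -(mulmx0 _ (lsubmx z.1))
     -mul_mx_row submxMl.
apply/mxrankS/row_subP => i; apply/mem_spanmx/imsetP.
exists (encode (row_mx (delta_mx 0 i) 0, 0)).
  rewrite inE imset_f //=; apply/eqP/lorow_eq0.
  have /eq_row_mx [_ /eq_row_mx [_ ->]] := digits_encode (row_mx (delta_mx 0 i) 0, 0).
  rewrite columns0 (_ : map_mx lo 0 = 0) ?row_mx0 //; apply/rowP => q; rewrite !mxE lo0 //.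
by rewrite /= row_mxKl rowE mul_mx_row mulmx1 mulmx0.
Qed.

(** High digits vanish on the [beta'] padding columns, so [rank_le_hirow] applies with [gamma' + e]
    rows. *)
Lemma span_dim_code_le :
  (span_dim (@digits alpha beta @: code) <= delta + kappa + (gamma' + e))%N.
Proof.
pose B : 'M['F_3]_(gamma' + e, beta) := col_mx (row_mx 1%:M 0) (row_mx 0 (row_mx 1%:M 0)).
apply: leq_trans (rank_le_hirow encodeD (B := B) _) _; last first.
  by rewrite span_dim_order3 leq_add2l rank_leq_row.
move=> _ /imsetP [z _ ->]; apply/submxP.
exists (row_mx (rsubmx z.1) (map_mx hi (columns z.2))).
rewrite mul_row_col !mul_mx_row !mulmx0 !mulmx1 add_row_mx addr0 add0r.
by have /eq_row_mx [_ /eq_row_mx [-> _]] := digits_encode z.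
Qed.

Lemma span_dim_code_ge :
  (delta + kappa + (gamma' + e) <= span_dim (@digits alpha beta @: code))%N.
Proof.
(* The independent coordinates: first block, high digits of the tripled block, low digits of the
   selected columns, and high digits of all columns. *)
pose pos (i : ('I_kappa + 'I_gamma') + ('I_delta + 'I_e)) : 'I_(alpha + (beta + beta)) :=
  match i with
  | inl (inl a) => lshift _ (lshift _ a)
  | inl (inr b) => rshift _ (lshift _ (lshift _ b))
  | inr (inl l) => rshift _ (rshift _ (rshift _ (lshift _ (sel l))))
  | inr (inr q) => rshift _ (lshift _ (rshift _ (lshift _ q)))
  end.
have -> : (delta + kappa + (gamma' + e))%N
    = #|{: ('I_kappa + 'I_gamma') + ('I_delta + 'I_e)}|.
  by rewrite !card_sum !card_ord; lia.
apply: (@span_dim_ge _ _ _ (fun i => delta_mx (pos i) 0)) => d dS.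
have val (v : 'rV['F_3]_(alpha + (beta + beta))) k : (v *m (delta_mx k 0 : 'cV_ _)) 0 0 = v 0 k.
  by rewrite -colE mxE.
have {dS} H (a : 'rV['F_3]_kappa) (b : 'rV['F_3]_gamma') (u : 'rV['Z_9]_delta) :
    \sum_i d (inl (inl i)) * a 0 i + \sum_j d (inl (inr j)) * b 0 j
    + (\sum_l d (inr (inl l)) * lo (u 0 l)
       + \sum_q d (inr (inr q)) * hi (\sum_x u 0 x *+ m q x)) = 0.
  have := dS (digits (encode (row_mx a b, u))).
  rewrite !imset_f // => /(_ isT); rewrite !big_sumType /= => E; rewrite -[RHS]E.
  congr (_ + _ + (_ + _)); apply: eq_bigr => i _; congr (_ * _); rewrite val digits_encode /=.
  - by rewrite !row_mxEl row_mxKl.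
  - by rewrite row_mxEr !row_mxEl row_mxKr.
  - by rewrite !row_mxEr row_mxEl mxE columns_sel.
  by rewrite row_mxEr row_mxEl row_mxEr row_mxEl !mxE.
have H1 (a : 'rV['F_3]_kappa) (b : 'rV['F_3]_gamma') :
    \sum_i d (inl (inl i)) * a 0 i + \sum_j d (inl (inr j)) * b 0 j = 0.
  have := H a b 0; rewrite [X in _ + (X + _)]big1 => [|l _]; last by rewrite mxE lo0 mulr0.
  rewrite [X in _ + (_ + X)]big1 ?addr0 // => q _.
  by rewrite big1 ?hi0 ?mulr0 // => x _; rewrite mxE mul0rn.
have sum_delta n (g : 'I_n -> 'F_3) i : \sum_j g j * (delta_mx 0 i : 'rV_n) 0 j = g i.
  rewrite (bigD1 i) //= big1 ?addr0 ?mxE ?eqxx ?mulr1 // => j /negbTE ne.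
  by rewrite mxE ne andbF mulr0.
have dX i : d (inl (inl i)) = 0.
  have := H1 (delta_mx 0 i) 0; rewrite sum_delta big1 ?addr0 // => j _.
  by rewrite mxE mulr0.
have dY i : d (inl (inr i)) = 0.
  have := H1 0 (delta_mx 0 i); rewrite sum_delta big1 ?add0r // => j _.
  by rewrite mxE mulr0.
(* The low digit of u_l is the high digit of 3 u_l, so both families become column functions with
   distinct exponents and [column_free] applies. *)
pose mm (j : 'I_delta + 'I_e) x :=
  match j with inl l => ((x == l) * 3)%N | inr q => m q x end.
have dJ : forall j, d (inr j) = 0.
  apply: (@column_free _ delta mm (fun j => d (inr j))) => [[l|q]||u] //=.
  - by rewrite (bigD1 l) //= eqxx big1 // => x /negbTE ->.
  - move=> [l|q] [l'|q'] //= eqm.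
    + by have := eqm l; rewrite /mm eqxx; case: eqVneq => [->|].
    + by case: (m_neq3 (q := q') (l := l)) => x; rewrite -[m q' x]/(mm (inr q') x) -eqm.
    + by case: (m_neq3 eqm).
    + by rewrite (m_inj eqm).
  rewrite big_sumType -[RHS](H 0 0 u) H1 add0r /=; congr (_ + _).
  apply: eq_bigr => l _; congr (_ * _); rewrite -hi_mul3; congr hi.
  rewrite (bigD1 l) //= big1 ?eqxx ?addr0 // => x /negbTE ->.
  by rewrite mulr0n.
by move=> [[i|i]|j].
Qed.

End Construction.

Local Close Scope ring_scope.

Lemma columns_exist delta t : 1 + delta + delta + t <= 'C(delta + 3, delta) ->
  exists (m : 'I_(delta + t) -> 'I_delta -> nat) (sel : 'I_delta -> 'I_(delta + t)),
    [/\ forall q, 0 < \sum_x m q x <= 3,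
        forall q q', m q =1 m q' -> q = q',
        forall l x, m (sel l) x = (x == l)
      & forall q l, ~ (m q =1 fun x => (x == l) * 3)].
Proof.
(* Entries in ['I_4] suffice for weights at most 3; there are ['C(delta + 3, delta)] such vectors.
   Removing 0, the e_l and the 3 e_l leaves room for [t] extra columns. *)
move=> le_t; pose T := (delta.-tuple 'I_4 : finType).
pose single c l : T := [tuple inord ((x == l) * c) | x < delta].
pose zero : T := [tuple ord0 | x < delta].
have singleE c l x : c <= 3 -> tnth (single c l) x = (x == l) * c :> nat.
  by move=> c3; rewrite tnth_mktuple inordK //; case: (x == l); rewrite ?mul1n.
pose low := [set w : T | \sum_(i <- w) i <= 3].
pose bad : {set T} := [set zero] :|: single 1 @: setT :|: single 3 @: setT.
have bad_le : #|bad| <= 1 + delta + delta.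
  apply: leq_trans (leq_card_setU _ _) _; apply: leq_add.
    apply: leq_trans (leq_card_setU _ _) _; rewrite cards1 leq_add2l.
    by apply: leq_trans (leq_imset_card _ _) _; rewrite cardsT card_ord.
  by apply: leq_trans (leq_imset_card _ _) _; rewrite cardsT card_ord.
have t_le : t <= #|low :\: bad|.
  rewrite cardsD card_partial_ord_partitions.
  have := subset_leq_card (subsetIr low bad); lia.
pose w (s : 'I_delta + 'I_t) : T :=
  match s with inl l => single 1 l | inr r => enum_val (widen_ord t_le r) end.
have w_extra r : w (inr r) \in low :\: bad by apply: enum_valP.
have w_inj : injective w.
  move=> [l|r] [l'|r'] //= E.
  - have := congr1 (fun v => nat_of_ord (tnth v l)) E; rewrite !singleE // eqxx.
    by case: eqVneq => [->|].
  - by have := w_extra r'; rewrite /= -E !inE imset_f ?orbT.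
  - by have := w_extra r; rewrite /= E !inE imset_f ?orbT.
  - by congr inr; apply/val_inj; exact: (congr1 val (enum_val_inj E)).
exists (fun q x => nat_of_ord (tnth (w (split q)) x)), (fun l => lshift t l); split.
- move=> q; case: (split q) => [l|r] /=.
    rewrite (eq_bigr (fun x => (x == l) * 1)) => [|x _]; last exact: singleE.
    by rewrite (bigD1 l) //= eqxx big1 // => x /negbTE ->.
  have := w_extra r; rewrite /= !inE !negb_or -!andbA; set v := enum_val _.
  case/and4P => nz _ _; rewrite big_tuple => ->; rewrite andbT lt0n.
  apply: contra nz; rewrite sum_nat_eq0 => /forallP v0.
  apply/eqP/eq_from_tnth => x; rewrite tnth_mktuple; apply/val_inj/eqP; exact: v0.
- move=> q q' E; apply: (can_inj splitK); apply: w_inj.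
  by apply: eq_from_tnth => x; apply/val_inj/E.
- by move=> l x; rewrite (unsplitK (inl l)) singleE // muln1.
move=> q l E; have {}E : w (split q) = single 3 l.
  by apply: eq_from_tnth => x; apply/val_inj; rewrite /= E singleE.
case: (split q) E => [l'|r] E.
  have := congr1 (fun v => nat_of_ord (tnth v l')) E; rewrite !singleE // eqxx.
  by case: eqP.
by have := w_extra r; rewrite E !inE imset_f ?orbT.
Qed.

(** Exponents of weight at most 3 are sorted by weight 0, 1, 2, 3; formally this is Pascal's rule
    used twice. *)
Lemma bin_add3 n : 'C(n + 3, n) = 1 + n + 'C(n + 1, 2) + 'C(n + 2, 3).
Proof.
rewrite -bin_sub ?leq_addr // addKn !addnS addn0 (binS n.+2 2) (binS n.+1 1) bin1; lia.
Qed.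

Theorem theorem6 (alpha beta gamma delta kappa : nat) :
  0 < alpha -> 0 < beta -> 0 < gamma -> 0 < delta -> 0 < kappa ->
  0 < gamma + delta <= beta + kappa ->
  kappa <= minn alpha gamma ->
  forall r : nat,
    (exists C : {set 'rV['F_3]_(alpha + beta * 3)},
        @is_linear_code_of_type alpha beta gamma delta kappa C /\ code_rank C = r)
    <->
    (gamma + 2 * delta <= r <=
       minn (beta + delta + kappa)
            (gamma + delta + 'C(delta + 1, 2) + 'C(delta + 2, 3))).
Proof.
move=> _ _ _ d_gt0 _ /andP [_ le_gd]; rewrite leq_min => /andP [le_ka le_kg] r.
split=> [[_ [[C [_ [[[f [fD [f_inj fC]]] kC] ->]]] <-]]|].
  rewrite /code_rank span_dim_Gray -fC leq_min; apply/and3P; split.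
  (* The code has 3^gamma 9^delta words and [digits] is injective, so the span needs dimension at
     least gamma + 2 delta. *)
  - rewrite -(leq_exp2l (m := 3)) //; apply: leq_trans (card_le_span_dim _).
    rewrite !card_imset //; last exact: digits_inj.
    by rewrite cardsT card_prod !card_mx card_Fp // card_ord !mul1n expnD expnM.
  - apply: leq_trans (rank_le_hirow fD (B := (1%:M)%R) _) _; first by move=> *; apply: submx1.
    by rewrite fC kC mxrank1; lia.
  exact: rank_le_monomials.
rewrite leq_min => /and3P [le_r r_le1 r_le2].
(* [t] is the number of columns beyond the [delta] identity ones: with e = delta + t, the rank delta
   + kappa + gamma' + e equals r. *)
have [t rE] : exists t, r = gamma + 2 * delta + t by exists (r - (gamma + 2 * delta)); lia.
have [alpha' aE] : exists alpha', alpha = kappa + alpha' by exists (alpha - kappa); lia.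
have [gamma' gE] : exists gamma', gamma = kappa + gamma' by exists (gamma - kappa); lia.
(* The first upper bound on r says exactly that gamma' + delta + t columns fit into beta. *)
have [beta' bE] : exists beta', beta = gamma' + (delta + t + beta').
  by exists (beta - gamma' - delta - t); lia.
subst r alpha gamma beta.
have [|m [sel [m_weight m_inj m_sel m_neq3]]] := @columns_exist delta t.
  (* The second upper bound on r says exactly that enough exponents are available. *)
  by rewrite bin_add3; lia.
pose C := @code kappa alpha' gamma' delta (delta + t) beta' m.
exists ((@Gray _ _) @: C); split.
  exists C; split; first exact: code_additive.
  split=> //; split; last exact: span_dim_order3.
  exists (@encode kappa alpha' gamma' delta (delta + t) beta' m).
  by split; [exact: encodeD | split; [exact: (encode_inj m_sel)|]].
rewrite /code_rank span_dim_Gray; apply/eqP; rewrite eqn_leq.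
apply/andP; split.
  by apply: leq_trans (span_dim_code_le _ _ _ _ _) _; lia.
by apply: leq_trans (span_dim_code_ge _ _ _ _ m_weight m_inj m_sel m_neq3); lia.
Qed.
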